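(* $\mathsf{D}_{\pm}(C_3 \oplus C_3 \oplus C_9) = 6$.
   Context: $C_m$ denotes a cyclic group of order $m$. For a finite abelian group $G$ (written additively), $\mathsf{D}_{\pm}(G)$ is the smallest positive integer $\ell$ such that for every sequence $g_1,\dots,g_k$ of elements of $G$ (repetitions allowed) with $k \ge \ell$ there exist a non-empty subset $I \subset \{1,\dots,k\}$ and $a_i \in \{+1,-1\}$ ($i\in I$) with $\sum_{i \in I} a_i g_i = 0$. *)

(* Defs.v *)
From HB Require Import structures.
From mathcomp Require Import all_boot all_order all_algebra.
From mathcomp Require Import boolp.

Set Implicit Arguments.
Unset Strict Implicit.
Unset Printing Implicit Defensive.

Import GRing.Theory.
Local Open Scope ring_scope.

(* The library has no finZmodType instance on products, although both parents
   (the direct sum zmodType and the finType) exist. *)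
HB.instance Definition _ (U V : finZmodType) := GRing.Zmodule.on (U * V)%type.

Definition has_pm_zero_sum (G : zmodType) (k : nat) (g : 'I_k -> G) : Prop :=
  exists I : {set 'I_k}, I != set0 /\
  exists a : 'I_k -> int,
    (forall i, i \in I -> a i = 1 \/ a i = -1) /\
    \sum_(i in I) g i *~ a i = 0.

Definition Dpm_bound (G : finZmodType) (l : nat) : Prop :=
  (0 < l)%N /\
  forall (k : nat) (g : 'I_k -> G), (l <= k)%N -> has_pm_zero_sum g.

(* By pigeonhole on partial sums, every sequence of length at least #|G| has a
   non-empty subsequence with sum zero. *)
Lemma Dpm_bound_card (G : finZmodType) : Dpm_bound G #|G|.
Proof.
split; first by apply/card_gt0P; exists 0.
move=> k g lek.
pose s (j : 'I_k.+1) : G := \sum_(i < k | (i < j)%N) g i.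
have [i [j [ltij eqs]]] : exists i j : 'I_k.+1, (i < j)%N /\ s i = s j.
  have /injectivePn[i [j neij eqs]] : ~~ injectiveb s.
    apply/negP => /injectiveP/leq_card; rewrite card_ord => lek'.
    by move: (leq_trans lek' lek); rewrite ltnn.
  have [ltij|ltji|/val_inj eij] := ltngtP i j.
  - by exists i, j.
  - by exists j, i.
  - by rewrite eij eqxx in neij.
have ltik : (i < k)%N by apply: leq_trans ltij _; rewrite -ltnS.
exists [set t : 'I_k | (i <= t < j)%N]; split.
  by apply/set0Pn; exists (Ordinal ltik); rewrite inE /= leqnn.
exists (fun=> 1); split; first by left.
have := eqs; rewrite /s [RHS](bigID (fun t : 'I_k => (t < i)%N)) /=.
rewrite [X in _ = X + _](eq_bigl (fun t : 'I_k => (t < i)%N)); last first.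
  by move=> t; apply/andP/idP => [[]//|lti]; split=> //; apply: ltn_trans ltij.
move=> /eqP; rewrite -{1}[X in X == _]addr0 (inj_eq (addrI _)) eq_sym.
move=> /eqP sum0; rewrite -[RHS]sum0; apply: eq_big => [t|t _]; last by rewrite mulr1z.
by rewrite inE -leqNgt andbC.
Qed.

Lemma Dpm_exists (G : finZmodType) : exists l, `[< Dpm_bound G l >].
Proof. by exists #|G|; apply/asboolP/Dpm_bound_card. Qed.

Definition Dpm (G : finZmodType) : nat := ex_minn (Dpm_exists G).

Lemma DpmP (G : finZmodType) :
  Dpm_bound G (Dpm G) /\ forall l, Dpm_bound G l -> (Dpm G <= l)%N.
Proof.
rewrite /Dpm; case: ex_minnP => m /asboolP bm minm.
by split=> // l bl; apply/minm/asboolP.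
Qed.

(* Main.v *)
(* A signed subsum with coefficients in {0, 1, -1} is a vector over F_3, lifted to
   balanced integers.  For six elements the equations mod 3 cut out a subspace of
   dimension at least 3 of F_3^6; on it the last coordinate is 3 times a cubic
   function, and a nontrivial zero of it is wanted (Chevalley-Warning would need
   four variables).  Writing c = e + 3d in Teichmueller digits, this function is a
   carry sum over the columns of a 3 x 6 matrix W with zero row sums, plus an
   arbitrary linear form.  If W has rank less than 3, the carry sum is constant
   along some direction, along which the linear form can be adjusted.  Otherwise
   three columns may be taken to be the standard basis, the sixth is determined by
   the fourth and fifth, and 27^3 cases remain to be checked.  The sequence showing
   that 5 is too small consists of the generators of order 3 and 1, 2, 4 in C_9. *)
Require Import Defs.
From mathcomp Require Import all_boot all_order all_algebra.

Set Implicit Arguments.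
Unset Strict Implicit.
Unset Printing Implicit Defensive.

Import GRing.Theory.

(** * Computation with natural number representatives *)

Definition trits := iota 0 3.
Definition triples : seq (nat * nat * nat) :=
  [seq (x, z) | x <- [seq (x, y) | x <- trits, y <- trits], z <- trits].

Definition dotn (x u : nat * nat * nat) :=
  x.1.1 * u.1.1 + x.1.2 * u.1.2 + x.2 * u.2.

(* The Teichmueller lift F_3 -> Z/9, with 8 standing for -1. *)
Definition teichn (n : nat) : nat :=
  match n %% 3 with 0 => 0 | 1 => 1 | _ => 8 end.

(* The last summand is the value at x of minus the sum of the standard basis, u
   and v, as 2 = -1 mod 3. *)
Definition carryn (u v x : nat * nat * nat) : nat :=
  teichn x.1.1 + teichn x.1.2 + teichn x.2
  + teichn (dotn x u) + teichn (dotn x v)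
  + teichn (2 * (x.1.1 + x.1.2 + x.2 + dotn x u + dotn x v)).

(* [behead] removes the zero triple; [F] is tabulated once for all [l]. *)
Definition carry_cubics_isotropic :=
  all (fun u => all (fun v =>
    let F := [seq (x, carryn u v x) | x <- behead triples] in
    all (fun l => has (fun xF => 9 %| xF.2 + 3 * dotn xF.1 l) F) triples)
    triples) triples.

Lemma carry_cubics_isotropicP : carry_cubics_isotropic.
Proof. by vm_compute. Qed.

Local Open Scope ring_scope.

(** * Teichmueller digits in Z/9 *)

Definition balanced (x : 'F_3) : int :=
  match val x with 0%N => 0 | 1%N => 1 | _ => -1 end.
(** In Z/9 the roots of t^3 = t are 0, 1 and -1, so the coefficients of a signed subsum are their
    own Teichmueller lifts. *)
Definition teich (x : 'F_3) : 'Z_9 := (balanced x)%:~R.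

Lemma F3_ind (P : 'F_3 -> Prop) : P 0 -> P 1 -> P (-1) -> forall x, P x.
Proof.
move=> P0 P1 P2 [[|[|[|//]]] lti].
- by rewrite (_ : Ordinal lti = 0) //; apply/val_inj.
- by rewrite (_ : Ordinal lti = 1) //; apply/val_inj.
- by rewrite (_ : Ordinal lti = -1) //; apply/val_inj.
Qed.

Lemma teich0 : teich 0 = 0.
Proof. by []. Qed.

Lemma teichM x y : teich (x * y) = teich x * teich y.
Proof. by elim/F3_ind: x; elim/F3_ind: y; apply/eqP. Qed.

(** The lift is additive modulo 3, and the factor 3 sees only residues modulo 3. *)
Lemma teich3D x y : 3 * teich (x + y) = 3 * teich x + 3 * teich y.
Proof. by elim/F3_ind: x; elim/F3_ind: y; apply/eqP. Qed.

Lemma teich3_sum (I : finType) (x : I -> 'F_3) :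
  3 * teich (\sum_i x i) = 3 * \sum_i teich (x i).
Proof.
rewrite mulr_sumr.
exact: (big_morph (fun y => 3 * teich y) teich3D (mulr0 3 : 3 * teich 0 = 0)).
Qed.

Lemma teich_natr n : teich n%:R = (teichn n)%:R.
Proof.
have pr3 : prime 3 by [].
rewrite -(Fp_nat_mod pr3) /teichn.
by case: (n %% 3)%N (ltn_pmod n (isT : 0 < 3)%N) => [|[|[|//]]] _; apply/eqP.
Qed.

Lemma teich3_natr n : 3 * teich n%:R = (3 * n)%:R.
Proof.
rewrite natrM; elim: n => [|n IHn]; first by rewrite !mulr0.
by rewrite -(addn1 n) !natrD teich3D IHn mulrDr.
Qed.

Lemma Z9_ind (P : 'Z_9 -> Prop) :
  (forall n, (n < 9)%N -> P n%:R) -> forall c, P c.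
Proof. by move=> Pn c; rewrite -(natr_Zp c); apply: Pn. Qed.

Lemma Z9_digits (c : 'Z_9) : exists e d, c = teich e + 3 * teich d.
Proof.
elim/Z9_ind: c; do 9 ?[case=> [_|]] => //.
- by exists 0, 0; apply/eqP.
- by exists 1, 0; apply/eqP.
- by exists (-1), 1; apply/eqP.
- by exists 0, 1; apply/eqP.
- by exists 1, 1; apply/eqP.
- by exists (-1), (-1); apply/eqP.
- by exists 0, (-1); apply/eqP.
- by exists 1, (-1); apply/eqP.
- by exists (-1), 0; apply/eqP.
Qed.

Lemma Z9_mul3_eq0 (c : 'Z_9) : 3 * c = 0 -> exists d, c = 3 * teich d.
Proof.
case: (Z9_digits c) => [e [d ->]].
have -> : 3 * (teich e + 3 * teich d) = 3 * teich e.
  by elim/F3_ind: d; rewrite ?addr0 //; elim/F3_ind: e; apply/eqP.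
by elim/F3_ind: e => // _; exists d; rewrite add0r.
Qed.

(** * Nontrivial zeros of carry cubics *)

Lemma carry_cubic_isotropic_degenerate (W : 'M['F_3]_(3, 6)) (l : 'cV['F_3]_3) (x : 'rV_3) :
  (forall j, \sum_i W j i = 0) -> x != 0 -> x *m W = 0 ->
  exists2 y : 'rV_3, y != 0 &
    \sum_i teich ((y *m W) 0 i) + 3 * teich ((y *m l) 0 0) = 0.
Proof.
move=> W0 nzx xW0.
(* Off the line of [x], so that [y + s *: x] is nonzero for every [s]. *)
have [y nyx] : exists y : 'rV['F_3]_3, ~~ (y <= x)%MS.
  have /row_subPn[i ?] : ~~ ((1%:M : 'M['F_3]_3) <= x)%MS.
    apply/negP => /mxrankS.
    by rewrite mxrank1 leqNgt ltnS (leq_trans (rank_leq_row x)).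
  by exists (row i 1%:M).
have [xl0 | nxl] := eqVneq ((x *m l) 0 0) 0.
  exists x => //; rewrite xW0 xl0 mulr0 addr0.
  by apply: big1 => i _; rewrite mxE.
(* The entries of [y *m W] sum to zero in F_3, so their lifts sum to a multiple of 3. *)
have [t Et] : exists t, \sum_i teich ((y *m W) 0 i) = 3 * teich t.
  apply: Z9_mul3_eq0; rewrite -teich3_sum.
  under eq_bigr do rewrite mxE.
  rewrite exchange_big big1 /= ?teich0 ?mulr0 // => j _.
  by rewrite -mulr_sumr W0 mulr0.
pose s := - (t + (y *m l) 0 0) / (x *m l) 0 0.
exists (y + s *: x).
  apply: contraNneq nyx => /eqP; rewrite addr_eq0 => /eqP ->.
  by rewrite -scaleNr scalemx_sub.
rewrite !mulmxDl -!scalemxAl xW0 scaler0 addr0 Et -teich3D.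
have -> : (y *m l + s *: (x *m l)) 0 0 = (y *m l) 0 0 + s * (x *m l) 0 0.
  by rewrite mxE; congr (_ + _); rewrite mxE.
by rewrite divfK // addrA addrN teich0 mulr0.
Qed.

Lemma mem_triples (x y z : 'F_3) : (val x, val y, val z) \in triples.
Proof. by elim/F3_ind: x; elim/F3_ind: y; elim/F3_ind: z. Qed.

Lemma behead_triples_neq0 : all (fun x => [|| x.1.1%:R != 0 :> 'F_3,
  x.1.2%:R != 0 :> 'F_3 | x.2%:R != 0 :> 'F_3]) (behead triples).
Proof. by []. Qed.

(** The normal form of the full rank case: the columns of [W] are the standard basis, [u], [v] and
    minus the sum of these five. *)
Lemma carry_cubic_isotropic_basis (u v l : 'I_3 -> 'F_3) :
  exists2 x : 'rV['F_3]_3, x != 0 &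
   \sum_j teich (x 0 j)
   + teich (\sum_j x 0 j * u j) + teich (\sum_j x 0 j * v j)
   + teich (- (\sum_j x 0 j + \sum_j x 0 j * u j + \sum_j x 0 j * v j))
   + 3 * teich (\sum_j x 0 j * l j) = 0.
Proof.
have /allP/(_ _ (mem_triples (u 0) (u 1) (u 2%:R))) := carry_cubics_isotropicP.
move/allP/(_ _ (mem_triples (v 0) (v 1) (v 2%:R))).
move/allP/(_ _ (mem_triples (l 0) (l 1) (l 2%:R))).
case/hasP => _ /mapP[[[a b] c] abcP ->] /= dvd9.
have E3 (F : 'I_3 -> 'F_3) : \sum_j F j = F 0 + F 1 + F 2%:R.
  by rewrite !big_ord_recr big_ord0 /= add0r; congr (F _ + F _ + F _); apply/val_inj.
have T3 (F : 'I_3 -> 'Z_9) : \sum_j F j = F 0 + F 1 + F 2%:R.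
  by rewrite !big_ord_recr big_ord0 /= add0r; congr (F _ + F _ + F _); apply/val_inj.
exists (\row_j (nth 0 [:: a; b; c] j)%:R).
  apply/eqP => /rowP x0; have := allP behead_triples_neq0 _ abcP.
  by have := x0 0; have := x0 1; have := x0 2%:R; rewrite !mxE /= => -> -> ->.
have val_F3 (y : 'F_3) : y = (val y)%:R by rewrite natr_Zp.
rewrite !E3 !T3 !mxE /=.
rewrite (val_F3 (u _)) (val_F3 (u 1)) (val_F3 (u 2%:R)).
rewrite (val_F3 (v _)) (val_F3 (v 1)) (val_F3 (v 2%:R)).
rewrite (val_F3 (l _)) (val_F3 (l 1)) (val_F3 (l 2%:R)).
rewrite -!natrM -!natrD -mulN1r (_ : -1 = 2%:R :> 'F_3) -?natrM; last exact/val_inj.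
rewrite teich3_natr !teich_natr -!natrD.
case/dvdnP: dvd9 => k; rewrite /carryn /dotn /= => ->.
by rewrite natrM (_ : 9%:R = 0) ?mulr0 //; apply/val_inj.
Qed.

Lemma carry_cubic_isotropic (W : 'M['F_3]_(3, 6)) (l : 'cV['F_3]_3) :
  (forall j, \sum_i W j i = 0) ->
  exists2 x : 'rV_3, x != 0 &
    \sum_i teich ((x *m W) 0 i) + 3 * teich ((x *m l) 0 0) = 0.
Proof.
move=> W0; have [Wfree | ] := boolP (row_free W); last first.
  rewrite -kermx_eq0 => /rowV0Pn[x /sub_kermxP xW0 nzx].
  exact: carry_cubic_isotropic_degenerate nzx xW0.
have Wfull : row_full W^T by rewrite /row_full mxrank_tr.
(* [f] picks three independent columns of [W]; the change of variables [invmx P] turns them into the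
   standard basis. *)
pose f := fullrankfun Wfull; have injf : injective f := @fullrankfun_inj _ _ _ _ Wfull.
pose P := colsub f W.
have Punit : P \in unitmx.
  by rewrite -unitmx_tr trmx_mxsub; apply: fullrowsub_unit.
pose Y := invmx P *m W.
have YP : colsub f Y = 1%:M by rewrite /Y -mulmx_colsub mulVmx.
pose A := ~: (f @: [set: 'I_3]).
have cardA : #|A| = 3.
  by rewrite cardsCs setCK card_imset // cardsT !card_ord.
have [a [b [c EA]]] : exists a b c, enum A = [:: a; b; c].
  have : size (enum A) = 3 by rewrite -cardE.
  by case: (enum A) => [|a [|b [|c [|]]]] // _; exists a, b, c.
have split_sum (V : zmodType) (F : 'I_6 -> V) :
    \sum_i F i = \sum_j F (f j) + F a + F b + F c.
  rewrite (bigID (mem A)) /= addrC -[X in _ + X]big_enum EA /= !big_cons big_nil addr0.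
  rewrite !addrA; congr (_ + _ + _ + _).
  rewrite (eq_bigl (mem (f @: [set: 'I_3]))) => [|i]; last by rewrite /A !inE negbK.
  rewrite big_imset /=; last by move=> ? ? _ _; apply: injf.
  by apply: eq_bigl => j; rewrite inE.
have Yf j k : Y j (f k) = (j == k)%:R by have /matrixP/(_ j k) := YP; rewrite !mxE.
have Y0 j : \sum_i Y j i = 0.
  under eq_bigr do rewrite mxE.
  rewrite exchange_big big1 //= => k _.
  by rewrite -mulr_sumr W0 mulr0.
have [z nzz z0] := carry_cubic_isotropic_basis (Y^~ a) (Y^~ b) (fun j => (invmx P *m l) j 0).
exists (z *m invmx P).
  by apply: contraNneq nzz => zP0; rewrite -(mulmxKV Punit z) zP0 mul0mx.
rewrite -!mulmxA -/Y split_sum -[RHS]z0.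
have zYf k : (z *m Y) 0 (f k) = z 0 k.
  rewrite mxE (bigD1 k) //= Yf eqxx mulr1 big1 ?addr0 // => j /negPf nkj.
  by rewrite Yf nkj mulr0.
(* This makes entry [c] minus the sum of the other five. *)
have zYsum : \sum_i (z *m Y) 0 i = 0.
  under eq_bigr do rewrite mxE.
  rewrite exchange_big big1 //= => k _.
  by rewrite -mulr_sumr Y0 mulr0.
move: zYsum; rewrite split_sum (eq_bigr (z 0)) // => /eqP.
rewrite addrC addr_eq0 => /eqP ->.
rewrite (eq_bigr (fun j => teich (z 0 j))) => [|j _]; last by rewrite zYf.
have zYE i : (z *m Y) 0 i = \sum_j z 0 j * Y j i by rewrite mxE.
by rewrite !zYE [(z *m (_ *m _)) 0 0]mxE.
Qed.

(** * Signed sums as vectors over F_3 *)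

Lemma row_free_kernel (F : fieldType) (k m r : nat) (M : 'M[F]_(k, m)) : (r + m <= k)%N ->
  exists2 B : 'M[F]_(r, k), row_free B & B *m M = 0.
Proof.
move=> le_rmk; have le_r_ker : (r <= \rank (kermx M))%N.
  rewrite mxrank_ker leq_subRL ?rank_leq_row // addnC.
  by rewrite (leq_trans _ le_rmk) // leq_add2l rank_leq_col.
exists (pid_mx r *m row_base (kermx M)).
  by rewrite -row_leq_rank mxrankMfree ?row_base_free // rank_pid_mx.
apply/sub_kermxP; apply: submx_trans (submxMl _ _) _.
by rewrite eq_row_base.
Qed.

Lemma pm_zero_sum_of_trits (V : zmodType) k (g : 'I_k -> V) (x : 'rV['F_3]_k) :
  x != 0 -> \sum_i g i *~ balanced (x 0 i) = 0 -> has_pm_zero_sum g.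
Proof.
move=> nzx gx0; exists [set i | x 0 i != 0]; split.
  apply: contraNneq nzx => x0; apply/eqP/rowP => i; rewrite mxE.
  by apply/eqP; have /setP/(_ i) := x0; rewrite !inE => /negbFE.
exists (fun i => balanced (x 0 i)); split.
  by move=> i; rewrite inE; elim/F3_ind: (x 0 i) => //; [left | right].
rewrite -[RHS]gx0 [RHS](bigID (fun i => x 0 i != 0)) /= [X in _ + X]big1 ?addr0.
  by apply: eq_bigl => i; rewrite inE.
by move=> i /negPn/eqP ->.
Qed.

Lemma sum_pairs (U V : zmodType) (I : finType) (F : I -> U * V) (n : I -> int) :
  \sum_i F i *~ n i = (\sum_i (F i).1 *~ n i, \sum_i (F i).2 *~ n i).
Proof.
rewrite [LHS]surjective_pairing.
by rewrite !raddf_sum /=; congr (_, _); apply: eq_bigr => i _; rewrite raddfMz.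
Qed.

(* The product [p * x] in ['Z_3] uses that ['F_3] is convertible to it. *)
Lemma Z3_balanced (p : 'Z_3) x : p *~ balanced x = p * x.
Proof. by rewrite -mulrzr; congr (_ * _); elim/F3_ind: x; apply/eqP. Qed.

Local Notation G := ('Z_3 * 'Z_3 * 'Z_9)%type.

Lemma six_trits (g : 'I_6 -> G) :
  exists2 x : 'rV['F_3]_6, x != 0 & \sum_i g i *~ balanced (x 0 i) = 0.
Proof.
have [e /fin_all_exists[d Ec]] := fin_all_exists (fun i => Z9_digits (g i).2).
(* Row [i] is [g i] modulo 3, so a vector killed by [M] settles both copies of C_3 and leaves a
   multiple of 3 in C_9. *)
pose M : 'M['F_3]_(6, 3) := \matrix_(i, j) nth 0 [:: (g i).1.1; (g i).1.2; e i] j.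
have [B freeB BM0] := @row_free_kernel _ 6 3 3 M isT.
have BM j i : \sum_k B j k * M k i = 0.
  by move/matrixP: BM0 => /(_ j i); rewrite !mxE.
(* As [teich] is multiplicative, the low digits contribute the lifts of the entries of [x *m W], and
   the high digits [d] give the linear form. *)
pose W : 'M['F_3]_(3, 6) := \matrix_(j, i) (B j i * e i).
have [|x nzx Ex] := @carry_cubic_isotropic W (B *m \col_i d i).
  move=> j; rewrite -[RHS](BM j 2%:R); apply: eq_bigr => i _.
  by rewrite !mxE.
exists (x *m B).
  apply: contraNneq nzx => xB0.
  by apply/eqP/(row_free_inj freeB); rewrite mul0mx.
have xM i : \sum_k M k i * (x *m B) 0 k = 0.
  have /matrixP/(_ 0 i) : x *m B *m M = 0 by rewrite -mulmxA BM0 mulmx0.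
  rewrite !mxE => xBM; rewrite -[RHS]xBM; apply: eq_bigr => k _.
  by rewrite mulrC.
rewrite !sum_pairs; congr (_, _, _).
- have := xM 0; under eq_bigr do rewrite mxE /=.
  by under [in X in _ -> X]eq_bigr do rewrite Z3_balanced.
- have := xM 1; under eq_bigr do rewrite mxE /=.
  by under [in X in _ -> X]eq_bigr do rewrite Z3_balanced.
rewrite -[RHS]Ex.
have -> : (x *m W) = \row_i ((x *m B) 0 i * e i).
  apply/rowP => i; rewrite !mxE mulr_suml; apply: eq_bigr => j _.
  by rewrite mxE mulrA.
rewrite mulmxA mxE teich3_sum mulr_sumr -big_split /=; apply: eq_bigr => i _.
rewrite !mxE -mulrzr -/(teich _) Ec.
by rewrite !teichM mulrDl mulrC -mulrA [teich (d i) * _]mulrC.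
Qed.

Lemma trits_of_pm_zero_sum (V : zmodType) k (g : 'I_k -> V) : has_pm_zero_sum g ->
  exists2 x : 'rV['F_3]_k, x != 0 & \sum_i g i *~ balanced (x 0 i) = 0.
Proof.
case=> I [/set0Pn[i0 Ii0] [a [a1 ga0]]].
have balanced_a i : i \in I -> balanced (a i)%:~R = a i by case/a1 => ->.
exists (\row_i if i \in I then (a i)%:~R else 0).
  apply/eqP => /rowP/(_ i0); rewrite !mxE Ii0.
  by case: (a1 _ Ii0) => -> /eqP.
rewrite -[RHS]ga0 [RHS]big_mkcond; apply: eq_bigr => i _.
by rewrite mxE; case: ifP => // /balanced_a ->.
Qed.

(** * The upper and lower bounds *)

Lemma Dpm_bound6 : Dpm_bound G 6.
Proof.
split=> // k g /subnKC Ek; move: (k - 6)%N Ek => m Ek; subst k.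
have [x nzx gx0] := six_trits (fun i => g (lshift m i)).
(* Terms after the sixth get coefficient 0. *)
apply: (@pm_zero_sum_of_trits _ _ _ (row_mx x 0)).
  by apply: contraNneq nzx => /eqP; rewrite -row_mx0 => /eqP/eq_row_mx[->].
rewrite big_split_ord /= -[RHS]addr0; congr (_ + _).
  by rewrite -[RHS]gx0; apply: eq_bigr => i _; rewrite row_mxEl.
by apply: big1 => i _; rewrite row_mxEr mxE.
Qed.

(** A signed subsum of 1, 2, 4 is a nonzero integer by its 2-adic valuation and at most 7 in
    absolute value, hence nonzero modulo 9. *)
Lemma not_Dpm_bound5 : ~ Dpm_bound G 5.
Proof.
pose s : seq G := [:: (1, 0, 0); (0, 1, 0); (0, 0, 1); (0, 0, 2); (0, 0, 4)].
case=> _ /(_ 5%N (fun i => s`_i) isT)/trits_of_pm_zero_sum[x nzx].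
rewrite !sum_pairs !big_ord_recl !big_ord0 /=.
set a := x 0 _; set b := x 0 _.
set c := x 0 _; set d := x 0 _; set e := x 0 _.
rewrite !mul0rz ?(add0r, addr0) => gx0.
have eq0 t : 1 *~ balanced t = 0 :> 'Z_3 -> t = 0 by elim/F3_ind: t => // /eqP.
have eq000 : [/\ c = 0, d = 0 & e = 0].
  move/(congr1 snd): gx0 => /=.
  by elim/F3_ind: (c); elim/F3_ind: (d); elim/F3_ind: (e) => // /eqP.
case: eq000 => c0 d0 e0.
have a0 : a = 0 by apply/eq0; have := congr1 (fun t => t.1.1) gx0.
have b0 : b = 0 by apply/eq0; have := congr1 (fun t => t.1.2) gx0.
case/negP: nzx; apply/eqP/rowP => -[[|[|[|[|[|//]]]]] ltj]; rewrite mxE.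
- by rewrite -[RHS]a0; congr (x _ _); apply/val_inj.
- by rewrite -[RHS]b0; congr (x _ _); apply/val_inj.
- by rewrite -[RHS]c0; congr (x _ _); apply/val_inj.
- by rewrite -[RHS]d0; congr (x _ _); apply/val_inj.
- by rewrite -[RHS]e0; congr (x _ _); apply/val_inj.
Qed.

Local Close Scope ring_scope.

Theorem theorem5p3 : Dpm ('Z_3 * 'Z_3 * 'Z_9)%type = 6.
Proof.
have [[Dgt0 boundD] minD] := DpmP ('Z_3 * 'Z_3 * 'Z_9)%type.
apply/eqP; rewrite eqn_leq minD ?ltnNge; last exact: Dpm_bound6.
apply/negP => leD5; apply: not_Dpm_bound5; split=> // k g le5k.
by apply: boundD; apply: leq_trans le5k.
Qed.
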